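(* For every relational specification $F(\mathbf{X},\mathbf{Y})$, there exists a Skolem function vector for $\mathbf{X}$ in $F$ of size polynomial in $|F|$ if and only if there exists a specification $\widetilde{F}(\mathbf{X},\mathbf{Y})$ in $\mathsf{SynNNF}$ (w.r.t. $\mathbf{X}$) such that $\widetilde{F}\preceq_{syn}F$ and the size of $\widetilde{F}$ is polynomial in $|F|$.
   Context: Outputs $\mathbf{X}=(x_1,\ldots,x_n)$, inputs $\mathbf{Y}$. Sizes are sizes of AND/OR/NOT circuit (DAG) representations. A Skolem function vector for $\mathbf{X}$ in $F$ is $\Psi=(\psi_1(\mathbf{Y}),\ldots,\psi_n(\mathbf{Y}))$ with $\forall\mathbf{Y}\,(\exists\mathbf{X}\,F(\mathbf{X},\mathbf{Y})\Leftrightarrow F(\Psi(\mathbf{Y}),\mathbf{Y}))$. $\widetilde{F}\preceq_{syn}F$ means: (a) $\forall\mathbf{Y}\,(\exists\mathbf{X}\,F(\mathbf{X},\mathbf{Y})\Rightarrow\exists\mathbf{X}'\,\widetilde{F}(\mathbf{X}',\mathbf{Y}))$ and (b) $\forall\mathbf{Y}\,\forall\mathbf{X}'\,((\exists\mathbf{X}\,F(\mathbf{X},\mathbf{Y})\wedge\widetilde{F}(\mathbf{X}',\mathbf{Y}))\Rightarrow F(\mathbf{X}',\mathbf{Y}))$. NNF: only $\wedge,\vee,\neg$, negation only on variables. Positive form $\widehat{G}$ of an NNF formula $G$: replace each $\neg x_i$ by a fresh variable $\overline{x}_i$. $i$-th reduct $\widehat{G}^{\,i}$: $\widehat{G}$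 with $x_1,\ldots,x_{i-1},\overline{x}_1,\ldots,\overline{x}_{i-1}$ set to $1$. With $\alpha_i^{jk}=\widehat{G}^{\,i}[x_i\mapsto j,\overline{x}_i\mapsto k,\overline{x}_l\mapsto\neg x_l\ (l>i)]$, $\widehat{G}^{\,i}$ is $\wedge_i$-unrealizable if $\alpha_i^{11}\wedge\neg\alpha_i^{10}\wedge\neg\alpha_i^{01}$ is unsatisfiable. $G$ is in $\mathsf{SynNNF}$ w.r.t. $\mathbf{X}$ if $G$ is in NNF and $\widehat{G}^{\,i}$ is $\wedge_i$-unrealizable for all $1\le i\le n$. *)

(* Defs.v *)
From mathcomp Require Import all_boot all_order all_algebra.
Set Implicit Arguments.
Unset Strict Implicit.
Unset Printing Implicit Defensive.

(* Circuits are DAGs listed in topological order: a gate refers to its children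
   by their positions in the list.  Constants are allowed as leaves, since a
   Skolem function for a specification without inputs is a constant. *)
Inductive gate (V : Type) : Type :=
| GVar of V
| GConst of bool
| GNot of nat
| GAnd of nat & nat
| GOr of nat & nat.

Arguments GConst {V}.
Arguments GNot {V}.
Arguments GAnd {V}.
Arguments GOr {V}.

Definition refs_below (V : Type) (k : nat) (g : gate V) : bool :=
  match g with
  | GVar _ | GConst _ => true
  | GNot a => a < k
  | GAnd a b | GOr a b => (a < k) && (b < k)
  end.

Fixpoint topological (V : Type) (k : nat) (gs : seq (gate V)) : bool :=
  if gs is g :: gs' then refs_below k g && topological k.+1 gs' else true.

Record circuit (V : Type) (k : nat) : Type := Circuit {
  nodes : seq (gate V);
  outputs : k.-tuple nat;
  nodes_ok : topological 0 nodes;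
  outputs_ok : all (fun o => o < size nodes) outputs
}.

(* All nodes count, leaves included; nodes shared by several outputs count
   once. *)
Definition csize (V : Type) (k : nat) (c : circuit V k) : nat := size (nodes c).

Definition gate_val (V : Type) (e : V -> bool) (s : seq bool) (g : gate V) :
    bool :=
  match g with
  | GVar v => e v
  | GConst b => b
  | GNot a => ~~ nth false s a
  | GAnd a b => nth false s a && nth false s b
  | GOr a b => nth false s a || nth false s b
  end.

Definition node_vals (V : Type) (e : V -> bool) (gs : seq (gate V)) :
    seq bool :=
  foldl (fun s g => rcons s (gate_val e s g)) [::] gs.

Definition ceval (V : Type) (k : nat) (c : circuit V k) (e : V -> bool)
    (i : 'I_k) : bool :=
  nth false (node_vals e (nodes c)) (tnth (outputs c) i).

Inductive var (n m : nat) : Type :=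
| X of 'I_n
| Y of 'I_m.

Arguments X {n m}.
Arguments Y {n m}.

Definition spec (n m : nat) : Type := circuit (var n m) 1.

Definition holds (n m : nat) (F : spec n m) (x : 'I_n -> bool)
    (y : 'I_m -> bool) : bool :=
  ceval F (fun v => match v with X i => x i | Y j => y j end) ord0.

Definition skolem_vector (n m : nat) (F : spec n m) (Psi : circuit 'I_m n) :
    Prop :=
  forall y : 'I_m -> bool,
    (exists x : 'I_n -> bool, holds F x y) <-> holds F (ceval Psi y) y.

Definition refines_syn (n m : nat) (Ft F : spec n m) : Prop :=
  (forall y : 'I_m -> bool,
     (exists x : 'I_n -> bool, holds F x y) ->
     exists x' : 'I_n -> bool, holds Ft x' y) /\
  (forall (y : 'I_m -> bool) (x' : 'I_n -> bool),
     (exists x : 'I_n -> bool, holds F x y) /\ holds Ft x' y ->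
     holds F x' y).

Definition node_at (V : Type) (gs : seq (gate V)) (a : nat) : gate V :=
  nth (GConst false) gs a.

Definition is_nnf (V : Type) (k : nat) (c : circuit V k) : bool :=
  all (fun g => if g is GNot a then
                  if node_at (nodes c) a is GVar _ then true else false
                else true)
      (nodes c).

Inductive pvar (n m : nat) : Type :=
| PX of 'I_n
| PXbar of 'I_n
| PY of 'I_m.

Arguments PX {n m}.
Arguments PXbar {n m}.
Arguments PY {n m}.

(* A node negating the leaf x_i becomes the leaf xbar_i; the negations of
   inputs are kept.  Node positions do not change. *)
Definition pos_gate (n m : nat) (gs : seq (gate (var n m)))
    (g : gate (var n m)) : gate (pvar n m) :=
  match g with
  | GVar (X i) => GVar (PX i)
  | GVar (Y j) => GVar (PY j)
  | GConst b => GConst b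
  | GNot a => if node_at gs a is GVar (X i) then GVar (PXbar i) else GNot a
  | GAnd a b => GAnd a b
  | GOr a b => GOr a b
  end.

Lemma pos_nodes_ok (n m : nat) (gs0 : seq (gate (var n m))) (k : nat)
    (gs : seq (gate (var n m))) :
  topological k gs -> topological k (map (pos_gate gs0) gs).
Proof.
elim: gs k => [|g gs IHgs] k //= /andP[gk /IHgs->]; rewrite andbT.
by case: g gk => [[]| |a|a b|a b] //= ak; case: (node_at gs0 a) => [[]| | | |].
Qed.

Lemma pos_outputs_ok (n m : nat) (G : spec n m) :
  all (fun o => o < size (map (pos_gate (nodes G)) (nodes G))) (outputs G).
Proof. by rewrite size_map outputs_ok. Qed.

Definition positive_form (n m : nat) (G : spec n m) : circuit (pvar n m) 1 :=
  Circuit (pos_nodes_ok (nodes G) (nodes_ok G)) (pos_outputs_ok G).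

(* Substitutions are composed with evaluation; indices start at 0. *)
Definition reduct (n m : nat) (G : spec n m) (i : 'I_n)
    (e : pvar n m -> bool) : bool :=
  ceval (positive_form G)
    (fun v => match v with
              | PX l | PXbar l => if l < i then true else e v
              | PY _ => e v
              end)
    ord0.

Definition alpha (n m : nat) (G : spec n m) (i : 'I_n) (j k : bool)
    (x : 'I_n -> bool) (y : 'I_m -> bool) : bool :=
  reduct G i
    (fun v => match v with
              | PX l => if l == i then j else x l
              | PXbar l => if l == i then k else ~~ x l
              | PY l => y l
              end).

Definition and_unrealizable (n m : nat) (G : spec n m) (i : 'I_n) : Prop :=
  ~ exists (x : 'I_n -> bool) (y : 'I_m -> bool),
      [&& alpha G i true true x y, ~~ alpha G i true false x y
        & ~~ alpha G i false true x y].

Definition SynNNF (n m : nat) (G : spec n m) : Prop :=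
  is_nnf G /\ forall i : 'I_n, and_unrealizable G i.

(* Main.v *)
Require Import Defs.
From mathcomp Require Import all_boot all_order all_algebra.
From mathcomp Require Import zify.

Set Implicit Arguments.
Unset Strict Implicit.
Unset Printing Implicit Defensive.

(** A polynomial Skolem vector [Psi] is turned into the specification
    "[x_i <-> psi_i(Y)] for every [x_i]", with [Psi] rewritten in NNF by
    computing each gate together with its negation; in the positive form, the
    [i]-th conjunct becomes [1] at [(1,1)], [psi_i] at [(1,0)] and [~ psi_i] at
    [(0,1)], so no conjunction is realizable.  Conversely, for [G] in SynNNF the
    functions [psi_i := alpha_i^{10}(psi_{i+1}, ..., psi_n, Y)] are computed by
    one copy of [G] per output; monotonicity of the positive form gives
    [alpha_n^{11} = 1] whenever [G] is satisfiable, and [wedge_i]-unrealizability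
    lets the value [1] descend through the reducts down to [G(Psi(Y), Y)].

    The number of outputs is not bounded by the size of a specification, so in
    both directions only the outputs that occur in the circuit are treated. *)

(** * Evaluation of gate lists in topological order *)

Section NodeValues.
Variable V : Type.
Implicit Types (g : gate V) (gs hs : seq (gate V)) (e : V -> bool).

Lemma node_vals_rcons e gs g :
  node_vals e (rcons gs g)
  = rcons (node_vals e gs) (gate_val e (node_vals e gs) g).
Proof. by rewrite /node_vals -cats1 foldl_cat. Qed.

Lemma size_node_vals e gs : size (node_vals e gs) = size gs.
Proof.
by elim/last_ind: gs => [|gs g IH] //; rewrite node_vals_rcons !size_rcons IH.
Qed.

Lemma topological_cat k gs hs :
  topological k (gs ++ hs) = topological k gs && topological (k + size gs) hs.
Proof.
elim: gs k => [|g gs IH] k /=; first by rewrite addn0.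
by rewrite IH addSnnS andbA.
Qed.

Lemma topological_rcons gs g :
  topological 0 (rcons gs g) = topological 0 gs && refs_below (size gs) g.
Proof. by rewrite -cats1 topological_cat /= andbT. Qed.

Lemma topological_refs k gs a :
  topological k gs -> a < size gs -> refs_below (k + a) (node_at gs a).
Proof.
elim: gs k a => [|g gs IH] k [|a] //= /andP[gk /IH{}IH]; first by rewrite addn0.
by rewrite ltnS => /IH; rewrite addSnnS.
Qed.

Lemma refs_below_leq k l g : k <= l -> refs_below k g -> refs_below l g.
Proof. by case: g => [v|b|a|a b|a b] //= kl; lia. Qed.

Lemma nth_node_vals_cat e gs hs k :
  k < size gs ->
  nth false (node_vals e (gs ++ hs)) k = nth false (node_vals e gs) k.
Proof.
move=> lk; elim/last_ind: hs => [|hs h IH]; first by rewrite cats0.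
rewrite -rcons_cat node_vals_rcons nth_rcons size_node_vals size_cat.
by rewrite (leq_trans lk (leq_addr _ _)).
Qed.

Lemma gate_val_eq e e' s s' g k :
  refs_below k g -> (forall v, g = GVar v -> e v = e' v) ->
  (forall a, a < k -> nth false s a = nth false s' a) ->
  gate_val e s g = gate_val e' s' g.
Proof.
move=> gk Ee Es; case: g gk Ee => [v|b|a|a b|a b] //=.
- by move=> _; exact.
- by move=> /Es->.
- by move=> /andP[/Es-> /Es->].
- by move=> /andP[/Es-> /Es->].
Qed.

(** A gate reads only earlier positions, whose values are already final. The fold thus becomes a
    system of equations, on which the later inductions over positions rest. *)
Lemma nth_node_vals e gs k :
  topological 0 gs -> k < size gs ->
  nth false (node_vals e gs) k = gate_val e (node_vals e gs) (node_at gs k).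
Proof.
move=> tgs lk; have tk := topological_refs tgs lk; rewrite add0n in tk.
(* Cutting just after position [k] makes its gate the last one of the prefix. *)
rewrite -{1 2}(cat_take_drop k.+1 gs) nth_node_vals_cat; last first.
  by rewrite size_take; case: ifP => // _.
rewrite (take_nth (GConst false) lk) node_vals_rcons nth_rcons.
rewrite size_node_vals size_takel ?(ltnW lk) // ltnn eqxx.
apply: gate_val_eq tk _ _ => // a ak; rewrite -cats1 -catA nth_node_vals_cat //.
by rewrite size_takel // ltnW.
Qed.

Lemma eq_node_vals e e' gs :
  topological 0 gs ->
  (forall k v, k < size gs -> node_at gs k = GVar v -> e v = e' v) ->
  node_vals e gs = node_vals e' gs.
Proof.
move=> tgs Ee; apply: (eq_from_nth (x0 := false)).
  by rewrite !size_node_vals.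
move=> k; rewrite size_node_vals; elim/ltn_ind: k => k IH lk.
rewrite !nth_node_vals //; apply: gate_val_eq (topological_refs tgs lk) _ _.
  by move=> v; apply: Ee.
by move=> a; rewrite add0n => ak; apply: IH ak (ltn_trans ak lk).
Qed.

End NodeValues.

(** * Copying a circuit behind another one, with new leaves *)

Section Substitution.
Variables V W : Type.
Implicit Types (gs : seq (gate V)) (hs : seq (gate W)).

(** A leaf is replaced by exactly one gate, so a copy keeps its size and node [a] simply moves to
    [off + a]. *)
Definition subst_gate (off : nat) (sigma : V -> gate W) (g : gate V) : gate W :=
  match g with
  | GVar v => sigma v
  | GConst b => GConst b
  | GNot a => GNot (off + a)
  | GAnd a b => GAnd (off + a) (off + b)
  | GOr a b => GOr (off + a) (off + b)
  end.

Lemma topological_subst off (sigma : V -> gate W) gs k :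
  (forall v, refs_below off (sigma v)) -> topological k gs ->
  topological (off + k) (map (subst_gate off sigma) gs).
Proof.
move=> sigma_ok; elim: gs k => [|g gs IH] k //= /andP[gk /IH].
rewrite addnS => ->; rewrite andbT.
case: g gk => [v|b|a|a b|a b] //=; rewrite ?ltn_add2l // => _.
by apply: refs_below_leq (sigma_ok v); apply: leq_addr.
Qed.

(** The gates put on the leaves read only the prefix [hs], so the copy behaves like [gs] under the
    assignment that they induce. *)
Lemma node_vals_subst (e : W -> bool) hs (sigma : V -> gate W) gs :
  (forall v, refs_below (size hs) (sigma v)) -> topological 0 gs ->
  node_vals e (hs ++ map (subst_gate (size hs) sigma) gs)
  = node_vals e hs
    ++ node_vals (fun v => gate_val e (node_vals e hs) (sigma v)) gs.
Proof.
move=> sigma_ok; elim/last_ind: gs => [|gs g IH]; first by rewrite !cats0.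
rewrite topological_rcons => /andP[/IH{}IH gk].
rewrite map_rcons -rcons_cat !node_vals_rcons IH -rcons_cat.
have nthR s a : nth false (node_vals e hs ++ s) (size hs + a) = nth false s a.
  by rewrite nth_cat size_node_vals ltnNge leq_addr /= addKn.
congr rcons; case: g gk => [v|b|a|a b|a b] //=; rewrite ?nthR // => _.
apply: gate_val_eq (sigma_ok v) _ _ => // a ak.
by rewrite nth_cat size_node_vals ak.
Qed.

End Substitution.

(** * Positive forms: occurring outputs, monotonicity, descent through the reducts *)

Section Positive.
Variables n m : nat.
Implicit Types (gs hs : seq (gate (var n m))) (G : spec n m).
Implicit Types (x xb z : 'I_n -> bool) (y : 'I_m -> bool).

Definition penv x xb y (v : pvar n m) : bool :=
  match v with PX i => x i | PXbar i => xb i | PY j => y j end.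

Definition pos_nodes gs : seq (gate (pvar n m)) := map (pos_gate gs) gs.

Definition pholds G x xb y : bool := ceval (positive_form G) (penv x xb y) ord0.

Definition occurs gs (i : 'I_n) : bool :=
  has (fun g => if g is GVar (X j) then j == i else false) gs.

(** Each node names at most one output, so the number of outputs to treat is bounded by the circuit
    size, whatever [n] is. *)
Lemma card_occurs gs : #|[set i | occurs gs i]| <= size gs.
Proof.
elim: gs => [|g gs IH] /=; first by rewrite eq_card0 // => i; rewrite inE.
have [A [A1 sub]] : exists A : {set 'I_n},
    #|A| <= 1 /\ [set i | occurs (g :: gs) i] \subset A :|: [set i | occurs gs i].
  case: g => [[j|j]|b|a|a b|a b]; last 5 first.
  1-5: by exists set0; rewrite cards0; split=> //; apply/subsetP => i; rewrite !inE.
  exists [set j]; rewrite cards1; split=> //; apply/subsetP => i.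
  by rewrite !inE /occurs /= eq_sym.
rewrite (leq_trans (subset_leq_card sub)) //.
by rewrite (leq_trans (leq_card_setU _ _)) // -add1n leq_add.
Qed.

Lemma occurs_node gs k i :
  k < size gs -> node_at gs k = GVar (X i) -> occurs gs i.
Proof.
move=> lk gk; apply/(has_nthP (GConst false)); exists k => //.
by rewrite -/(node_at gs k) gk.
Qed.

Lemma node_at_pos gs k :
  k < size gs -> node_at (pos_nodes gs) k = pos_gate gs (node_at gs k).
Proof. by move=> lk; rewrite /node_at (nth_map (GConst false)). Qed.

Lemma pholdsE G x xb y :
  pholds G x xb y
  = nth false (node_vals (penv x xb y) (pos_nodes (nodes G)))
      (tnth (outputs G) ord0).
Proof. by []. Qed.

Lemma output_lt (V : Type) k (c : circuit V k) (i : 'I_k) :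
  tnth (outputs c) i < size (nodes c).
Proof. by have /allP := outputs_ok c; apply; apply: mem_tnth. Qed.

Lemma pos_topological gs : topological 0 gs -> topological 0 (pos_nodes gs).
Proof. exact: pos_nodes_ok. Qed.

Lemma size_pos gs : size (pos_nodes gs) = size gs.
Proof. exact: size_map. Qed.

(** A leaf [PXbar i] arises only from the negation of a leaf [X i], so [occurs] on the original
    nodes covers both literals. *)
Lemma eq_pholds G x xb x' xb' y :
  (forall i, occurs (nodes G) i -> x i = x' i /\ xb i = xb' i) ->
  pholds G x xb y = pholds G x' xb' y.
Proof.
move=> Ex; rewrite !pholdsE; congr nth; apply: eq_node_vals.
  exact/pos_topological/nodes_ok.
move=> k v; rewrite size_pos => lk; rewrite node_at_pos //.
have := topological_refs (nodes_ok G) lk; rewrite add0n.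
case gk: (node_at (nodes G) k) => [[i|j]|b|a|a b|a b] //= ak.
- by case=> <- /=; case: (Ex i) => //; apply: occurs_node gk.
- by case=> <-.
case ga: (node_at (nodes G) a) => [[i|j]|b|a'|a' b|a' b] //= [<-] /=.
by case: (Ex i) => //; exact: occurs_node (ltn_trans ak lk) ga.
Qed.

(** Strong induction on the position: the two circuits differ in kind only at the negation of a leaf
    [X i], and there both values are [~~ x i]. *)
Lemma holds_pholds G x y : holds G x y = pholds G x (fun i => ~~ x i) y.
Proof.
rewrite pholdsE /holds /ceval.
move: (tnth _ _) (output_lt G ord0) => k.
elim/ltn_ind: k => k IH lk; have tG := nodes_ok G.
have {}IH a : a < k -> _ := fun ak => IH a ak (ltn_trans ak lk).
have tk := topological_refs tG lk; rewrite add0n in tk.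
rewrite !nth_node_vals ?size_pos ?pos_topological // node_at_pos //.
case: (node_at _ k) tk => [[i|j]|b|a|a b|a b] //=; last 2 first.
- by move=> /andP[/IH-> /IH->].
- by move=> /andP[/IH-> /IH->].
move=> ak; have la := ltn_trans ak lk.
case ga: (node_at (nodes G) a) => [[i|j]|b|a'|a' b|a' b] /=; rewrite ?IH //.
by rewrite -IH // nth_node_vals // ga.
Qed.

Lemma eq_holds G x x' y :
  (forall i, occurs (nodes G) i -> x i = x' i) -> holds G x y = holds G x' y.
Proof. by move=> Ex; rewrite !holds_pholds; apply: eq_pholds => i /Ex->. Qed.

(** In NNF the negations that survive in the positive form sit on inputs, and [y] is shared by both
    sides; all other gates are monotone. *)
Lemma pholds_mono G x xb x' xb' y :
  is_nnf G -> (forall i, x i -> x' i) -> (forall i, xb i -> xb' i) ->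
  pholds G x xb y -> pholds G x' xb' y.
Proof.
move=> nnfG lex lexb; rewrite !pholdsE.
move: (tnth _ _) (output_lt G ord0) => k.
elim/ltn_ind: k => k IH lk; have tG := nodes_ok G.
have {}IH a : a < k -> _ := fun ak => IH a ak (ltn_trans ak lk).
have tk := topological_refs tG lk; rewrite add0n in tk.
rewrite !nth_node_vals ?size_pos ?pos_topological // node_at_pos //.
have := all_nthP (GConst false) nnfG k lk.
rewrite -/(node_at (nodes G) k).
case: (node_at _ k) tk => [[i|j]|b|a|a b|a b] //=; first by move=> _ _; apply: lex.
- move=> ak; have la := ltn_trans ak lk.
  case ga: (node_at (nodes G) a) => [[i|j]|b|a'|a' b|a' b] //= _; first exact: lexb.
  rewrite !nth_node_vals ?size_pos ?pos_topological // node_at_pos //.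
  by rewrite ga.
- by move=> /andP[/IH ha /IH hb] _ /andP[/ha-> /hb->].
- by move=> /andP[/IH ha /IH hb] _ /orP[/ha->|/hb->]; rewrite ?orbT.
Qed.

Lemma alphaE G i j k x y :
  alpha G i j k x y
  = pholds G (fun l => (l < i) || (if l == i then j else x l))
             (fun l => (l < i) || (if l == i then k else ~~ x l)) y.
Proof.
rewrite /alpha /reduct /pholds /ceval; congr nth; apply: eq_node_vals.
  exact/pos_topological/nodes_ok.
by move=> a [l|l|l] _ _ //=; case: ifP.
Qed.

(** Invariant [A k]: the positive form is 1 when both literals of every output below [n - k] are 1
    and the rest follow [z]. At [k = 0] this is monotonicity applied to [G(x, y)]; at [k = n] it is
    [G(z, y)]. *)
Lemma SynNNF_skolem G z x y :
  SynNNF G -> (forall i, occurs (nodes G) i -> z i = alpha G i true false z y) ->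
  holds G x y -> holds G z y.
Proof.
case=> nnfG unreal zE Gx.
have A k : k <= n -> pholds G (fun l => (l < n - k) || z l)
                              (fun l => (l < n - k) || ~~ z l) y.
  elim: k => [|k IH] kn.
    rewrite subn0; move: Gx; rewrite holds_pholds.
    by apply: pholds_mono => // i _; rewrite ltn_ord.
  have {IH} := IH (ltnW kn).
  have ik : n - k.+1 < n by lia.
  pose i := Ordinal ik; have -> : n - k = i.+1 by rewrite /=; lia.
  rewrite -[n - k.+1]/(i : nat); have ltS l : (l < i.+1) = (l < i) || (l == i).
    by rewrite ltnS leq_eqVlt orbC.
  (* If [i] does not occur, releasing its two literals changes nothing. *)
  case: (boolP (occurs (nodes G) i)) => [occ|nocc]; last first.
    move=> h; rewrite (eq_pholds (x' := fun l => (l < i.+1) || z l)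
      (xb' := fun l => (l < i.+1) || ~~ z l)) // => l occ.
    rewrite ltS; case: eqP => [/val_inj li|]; last by rewrite orbF.
    by rewrite li (negbTE nocc) in occ.
  (* The invariant one level up is exactly the value 1 of [alpha] at [(1,1)]. *)
  move=> h; have a11 : alpha G i true true z y.
    rewrite alphaE; move: h; rewrite (eq_pholds
      (x' := fun l => (l < i) || (if l == i then true else z l))
      (xb' := fun l => (l < i) || (if l == i then true else ~~ z l))) // => l _.
    by rewrite !ltS -val_eqE; case: (l < i); case: (val l == val i).
  have : alpha G i (z i) (~~ z i) z y.
    (* If [z i] is 1, this is the defining equation of [z i]. Otherwise [alpha] is 0 at [(1,0)], and
       unrealizability forces it to be 1 at [(0,1)]. *)
    case zi: (z i); first by rewrite -zE.
    apply/negPn/negP => a01; apply: (unreal i); exists z, y.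
    by rewrite a11 -zE // zi.
  rewrite alphaE (eq_pholds (x' := fun l => (l < i) || z l)
    (xb' := fun l => (l < i) || ~~ z l)) // => l _.
  by case: eqP => [->|].
have := A n (leqnn n); rewrite subnn holds_pholds.
by rewrite (eq_pholds (x' := z) (xb' := fun l => ~~ z l)).
Qed.

End Positive.

(** * From a SynNNF specification to a Skolem circuit *)

Section FromSynNNF.
Variables (n m : nat) (G : spec n m).

(* The copy of [G] computing [psi_i] has these leaves, where node [o l] computes
   [psi_l]; [GAnd a a] repeats node [a]. *)
Definition alpha_leaf (o : 'I_n -> nat) (i : 'I_n) (v : pvar n m) : gate 'I_m :=
  match v with
  | PX l => if l <= i then GConst true else GAnd (o l) (o l)
  | PXbar l => if l < i then GConst true
               else if l == i then GConst false else GNot (o l)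
  | PY j => GVar j
  end.

(** Induction from the last output down: each occurring output appends one copy of the positive
    form, reading the nodes [o l] with [l > i]. As [alpha] at index [i] depends on [z] only above
    [i], redirecting [o i] preserves the equations already obtained. *)
Lemma alpha_nodes k :
  k <= n ->
  exists (hs : seq (gate 'I_m)) (o : 'I_n -> nat),
    [/\ topological 0 hs, forall i, o i < size hs,
        size hs <= 1 + csize G * #|[set i | occurs (nodes G) i & n - k <= i]|
      & forall y (i : 'I_n), n - k <= i -> occurs (nodes G) i ->
          let z l := nth false (node_vals y hs) (o l) in
          z i = alpha G i true false z y].
Proof.
elim: k => [|k IH] kn.
  (* The single constant node is a valid position for every untreated output, and is the [1] of the
     size bound. *)
  exists [:: GConst false], (fun=> 0); split=> //.
  by move=> y i; rewrite subn0 leqNgt ltn_ord.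
have [hs [o [ths o_lt szhs zE]]] := IH (ltnW kn).
have ik : n - k.+1 < n by lia.
pose i := Ordinal ik.
have leE (l : 'I_n) : (n - k.+1 <= l) = (l == i) || (n - k <= l).
  by rewrite -val_eqE /=; lia.
case: (boolP (occurs (nodes G) i)) => [occ|nocc]; last first.
  exists hs, o; split=> //.
    rewrite (leq_trans szhs) // leq_add2l leq_mul2l subset_leq_card ?orbT //.
    by apply/subsetP => l; rewrite !inE leE => /andP[-> ->]; rewrite orbT.
  move=> y l; rewrite leE => /orP[/eqP-> occ|]; last exact: zE.
  by rewrite occ in nocc.
have leaf_ok v : refs_below (size hs) (alpha_leaf o i v).
  case: v => [l|l|j] //=; first by case: ifP => //= _; rewrite o_lt.
  by case: ifP => // _; case: ifP => //= _; rewrite o_lt.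
pose ps := pos_nodes (nodes G).
have tps : topological 0 ps by apply/pos_topological/nodes_ok.
exists (hs ++ map (subst_gate (size hs) (alpha_leaf o i)) ps).
exists (fun l => if l == i then size hs + tnth (outputs G) ord0 else o l).
have zold y (l : 'I_n) : l != i ->
    nth false (node_vals y (hs ++ map (subst_gate (size hs) (alpha_leaf o i)) ps))
      (if l == i then size hs + tnth (outputs G) ord0 else o l)
    = nth false (node_vals y hs) (o l).
  by move=> /negbTE->; rewrite nth_node_vals_cat.
split.
- rewrite topological_cat ths add0n -[X in topological X]addn0.
  exact: topological_subst.
- move=> l; rewrite size_cat size_map size_pos; case: ifP => _.
    by rewrite ltn_add2l output_lt.
  by rewrite (leq_trans (o_lt l)) // leq_addr.
- rewrite size_cat size_map size_pos -/(csize G).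
  (* The new element [i] of the set pays for the new copy. *)
  set A := [set _ | _]; have -> : A = i |: [set l | occurs (nodes G) l & n - k <= l].
    apply/setP => l; rewrite !inE leE.
    by case: eqP => [->|]; rewrite ?occ.
  rewrite cardsU1 inE occ /= (_ : (n - k <= n - k.+1) = false); last by lia.
  by rewrite mulnDr muln1 addnCA addnC leq_add2l.
(* For an older [l > i], the indices below [l] are masked by 1 and those above differ from [i], so
   the update is invisible. For [l = i], the leaves of the copy are compared with the assignment
   inside [alpha]. *)
move=> y l; rewrite leE; case: (eqVneq l i) => [-> _ _|li /= lk occl]; last first.
  rewrite zold // zE // !alphaE; apply: eq_pholds => l' _.
  case: (ltnP l' l) => //= ll'; case: (eqVneq l' l) => // nl'.
  by rewrite zold //; apply: contraTneq ll' => ->; rewrite /=; lia.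
rewrite /= eqxx alphaE pholdsE [in LHS]node_vals_subst //.
rewrite nth_cat size_node_vals ltnNge leq_addr /= addKn.
congr nth; apply: eq_node_vals => // a [l'|l'|j] _ _ //=.
- case: (ltngtP l' i) => [//|il'|/val_inj->] /=; last by rewrite eqxx.
  have li : l' != i by rewrite -val_eqE gtn_eqF.
  by rewrite zold // (negbTE li) andbb.
- case: (ltnP l' i) => //= _; case: (eqVneq l' i) => // li.
  by rewrite nth_node_vals_cat.
Qed.

(** There are at most [csize G] copies of [G], hence the square. *)
Lemma SynNNF_skolem_circuit :
  SynNNF G ->
  exists Psi : circuit 'I_m n,
    csize Psi <= 1 + csize G * csize G /\
    forall x y, holds G x y -> holds G (ceval Psi y) y.
Proof.
move=> synG; have [hs [o [ths o_lt szhs zE]]] := alpha_nodes (leqnn n).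
have outs_ok : all (fun a => a < size hs) [tuple o i | i < n].
  by apply/allP => a /mapP[i _ ->].
exists (Circuit ths outs_ok); split.
  rewrite /csize /= (leq_trans szhs) // leq_add2l leq_mul2l; apply/orP; right.
  rewrite (leq_trans _ (card_occurs (nodes G))) // subset_leq_card //.
  by apply/subsetP => i; rewrite !inE => /andP[].
move=> x y Gx; pose z l := nth false (node_vals y hs) (o l).
rewrite (eq_holds (x' := z)); last by move=> i _; rewrite /ceval tnth_mktuple.
by apply: SynNNF_skolem Gx => // i occ; apply: zE => //; rewrite subnn.
Qed.

End FromSynNNF.

(** * From a Skolem circuit to a SynNNF specification *)

Section FromSkolem.
Variables n m : nat.
Implicit Types (gs hs : seq (gate (var n m))) (e : pvar n m -> bool).

(** The test inside [is_nnf], stated for a list of gates still under construction. *)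
Definition nnf_gate gs (g : gate (var n m)) : bool :=
  if g is GNot a then if node_at gs a is GVar _ then true else false else true.

Definition nnf_nodes gs : bool := topological 0 gs && all (nnf_gate gs) gs.

Lemma node_at_rcons gs g a : a < size gs -> node_at (rcons gs g) a = node_at gs a.
Proof. by move=> la; rewrite /node_at nth_rcons la. Qed.

Lemma nnf_gate_rcons gs g h :
  refs_below (size gs) h -> nnf_gate (rcons gs g) h = nnf_gate gs h.
Proof. by case: h => //= a la; rewrite node_at_rcons. Qed.

Lemma pos_gate_rcons gs g h :
  refs_below (size gs) h -> pos_gate (rcons gs g) h = pos_gate gs h.
Proof. by case: h => //= a la; rewrite node_at_rcons. Qed.

Lemma topological_refs_size gs k :
  topological 0 gs -> k < size gs -> refs_below (size gs) (node_at gs k).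
Proof.
by move=> tgs lk; apply: refs_below_leq (ltnW lk) (topological_refs tgs lk).
Qed.

Lemma nnf_nodes_rcons gs g :
  nnf_nodes gs -> refs_below (size gs) g -> nnf_gate gs g ->
  nnf_nodes (rcons gs g).
Proof.
move=> /andP[tgs nnf] gk gn; rewrite /nnf_nodes topological_rcons tgs gk /=.
rewrite all_rcons nnf_gate_rcons // gn /=.
apply/(all_nthP (GConst false)) => k lk; rewrite nnf_gate_rcons.
  exact: (all_nthP (GConst false) nnf).
exact: topological_refs_size.
Qed.

Lemma pos_nodes_rcons gs g :
  topological 0 (rcons gs g) ->
  pos_nodes (rcons gs g) = rcons (pos_nodes gs) (pos_gate gs g).
Proof.
rewrite topological_rcons => /andP[tgs gk].
rewrite /pos_nodes map_rcons pos_gate_rcons //; congr rcons.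
apply: (eq_from_nth (x0 := GConst false)); rewrite !size_map // => k lk.
rewrite !(nth_map (GConst false)) // pos_gate_rcons //.
exact: topological_refs_size.
Qed.

(** Values are taken in the positive form, with [x_i] and its barred copy independent, since
    unrealizability is a condition on that form. *)
Definition computes gs (k : nat) (f : (pvar n m -> bool) -> bool) : Prop :=
  k < size gs /\ forall e, nth false (node_vals e (pos_nodes gs)) k = f e.

Lemma computes_rcons gs g k f :
  nnf_nodes (rcons gs g) -> computes gs k f -> computes (rcons gs g) k f.
Proof.
move=> /andP[tgs _] [lk fE]; split=> [|e]; first by rewrite size_rcons leqW.
by rewrite pos_nodes_rcons // -cats1 nth_node_vals_cat // size_pos.
Qed.

Lemma computes_last gs g f :
  nnf_nodes (rcons gs g) ->
  (forall e, gate_val e (node_vals e (pos_nodes gs)) (pos_gate gs g) = f e) ->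
  computes (rcons gs g) (size gs) f.
Proof.
move=> /andP[tgs _] fE; split=> [|e]; first by rewrite size_rcons.
by rewrite pos_nodes_rcons // node_vals_rcons nth_rcons size_node_vals size_pos
  ltnn eqxx.
Qed.

(** Growth with a node budget [d]: positions found earlier stay usable, so constructions compose
    with additive cost. *)
Definition nnf_extends gs (d : nat) gs' : Prop :=
  [/\ nnf_nodes gs', size gs' <= size gs + d
    & forall k f, computes gs k f -> computes gs' k f].

Lemma nnf_extends_trans gs d gs1 d1 gs2 :
  nnf_extends gs d gs1 -> nnf_extends gs1 d1 gs2 -> nnf_extends gs (d + d1) gs2.
Proof.
move=> [_ sz1 c1] [nnf2 sz2 c2]; split=> // [|k f /c1/c2 //].
by rewrite (leq_trans sz2) // addnA leq_add2r.
Qed.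

Lemma nnf_extends_rcons gs g :
  nnf_nodes gs -> refs_below (size gs) g -> nnf_gate gs g ->
  nnf_extends gs 1 (rcons gs g).
Proof.
move=> nnf gk gn; have nnf' := nnf_nodes_rcons nnf gk gn.
by split; rewrite ?size_rcons ?addn1 // => k f; apply: computes_rcons.
Qed.

Lemma nnf_const gs b :
  nnf_nodes gs ->
  exists gs' k, nnf_extends gs 1 gs' /\ computes gs' k (fun=> b).
Proof.
move=> nnf; have ext := nnf_extends_rcons (g := GConst b) nnf isT isT.
by exists (rcons gs (GConst b)), (size gs); split=> //; case: ext => nnf' _ _;
  apply: computes_last.
Qed.

Lemma nnf_and gs a b f h :
  nnf_nodes gs -> computes gs a f -> computes gs b h ->
  exists gs' k, nnf_extends gs 1 gs' /\ computes gs' k (fun e => f e && h e).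
Proof.
move=> nnf [la fE] [lb hE].
have ext : nnf_extends gs 1 (rcons gs (GAnd a b)).
  by apply: nnf_extends_rcons => //=; rewrite la.
exists (rcons gs (GAnd a b)), (size gs); split=> //; case: ext => nnf' _ _.
by apply: computes_last => //= e; rewrite fE hE.
Qed.

Lemma nnf_or gs a b f h :
  nnf_nodes gs -> computes gs a f -> computes gs b h ->
  exists gs' k, nnf_extends gs 1 gs' /\ computes gs' k (fun e => f e || h e).
Proof.
move=> nnf [la fE] [lb hE].
have ext : nnf_extends gs 1 (rcons gs (GOr a b)).
  by apply: nnf_extends_rcons => //=; rewrite la.
exists (rcons gs (GOr a b)), (size gs); split=> //; case: ext => nnf' _ _.
by apply: computes_last => //= e; rewrite fE hE.
Qed.

(** Only here are negations created, each on a fresh leaf: this secures NNF, and makes the negated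
    output leaf read as [PXbar]. *)
Lemma nnf_literals gs (v : var n m) :
  nnf_nodes gs ->
  exists gs' k k', [/\ nnf_extends gs 2 gs',
    computes gs' k (fun e => match v with X i => e (PX i) | Y j => e (PY j) end)
    & computes gs' k'
        (fun e => match v with X i => e (PXbar i) | Y j => ~~ e (PY j) end)].
Proof.
move=> nnf; pose gs1 := rcons gs (GVar v).
have ext1 : nnf_extends gs 1 gs1 by apply: nnf_extends_rcons.
have nnf1 : nnf_nodes gs1 by case: ext1.
have c1 : computes gs1 (size gs)
    (fun e => match v with X i => e (PX i) | Y j => e (PY j) end).
  by apply: computes_last => // e; rewrite /=; case: (v).
have at1 : node_at gs1 (size gs) = GVar v.
  by rewrite /node_at nth_rcons ltnn eqxx.
have ext2 : nnf_extends gs1 1 (rcons gs1 (GNot (size gs))).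
  by apply: nnf_extends_rcons; rewrite //= ?size_rcons // at1.
exists (rcons gs1 (GNot (size gs))), (size gs), (size gs1).
case: (ext2) => nnf2 _ keep; split; [exact: nnf_extends_trans ext1 ext2 | exact: keep |].
apply: computes_last => // e; rewrite /= at1.
by case: (v) (proj2 c1 e) => [i|j] //= ->.
Qed.

(** De Morgan: conjunction and disjunction trade places on the negative rail, and [GNot] swaps the
    rails without a new node. Every other gate costs at most two nodes. *)
Lemma nnf_double_rail (hs : seq (gate 'I_m)) :
  topological 0 hs ->
  exists gs, [/\ nnf_nodes gs, size gs <= 2 * size hs
    & forall a, a < size hs -> exists k k',
        computes gs k (fun e => nth false (node_vals (fun j => e (PY j)) hs) a) /\
        computes gs k'
          (fun e => ~~ nth false (node_vals (fun j => e (PY j)) hs) a)].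
Proof.
elim/last_ind: hs => [_|hs g IH]; first by exists [::].
rewrite topological_rcons => /andP[/IH{IH}[gs [nnf sz rails]] gk].
pose val e := gate_val (fun j => e (PY j)) (node_vals (fun j => e (PY j)) hs) g.
have compE gs1 k f f' : computes gs1 k f -> (forall e, f e = f' e) ->
    computes gs1 k f'.
  by move=> [lk fE] ff'; split=> // e; rewrite fE.
suff [gs' [k [k' [[nnf' sz' keep] ck ck']]]] : exists gs' k k',
    [/\ nnf_extends gs 2 gs', computes gs' k val
       & computes gs' k' (fun e => ~~ val e)].
  exists gs'; split=> //; first by rewrite size_rcons; lia.
  move=> a; rewrite size_rcons ltnS leq_eqVlt => /orP[/eqP->|la].
    exists k, k'; split; [apply: compE ck _ | apply: compE ck' _] => e;
      by rewrite node_vals_rcons nth_rcons size_node_vals ltnn eqxx.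
  have [c [c' [/keep cc /keep cc']]] := rails a la; exists c, c'.
  split; [apply: compE cc _ | apply: compE cc' _] => e;
    by rewrite node_vals_rcons nth_rcons size_node_vals la.
case: g gk @val => [j|b|a|a b|a b] /= gk.
- exact: nnf_literals (Y j) nnf.
- have [gs1 [k [ext1 ck]]] := nnf_const b nnf; case: (ext1) => nnf1 _ _.
  have [gs2 [k' [ext2 ck']]] := nnf_const (~~ b) nnf1; case: (ext2) => _ _ keep2.
  exists gs2, k, k'; split=> //; first exact: nnf_extends_trans ext1 ext2.
  exact: keep2.
- have [k [k' [ck ck']]] := rails a gk.
  exists gs, k', k; split=> //; first by split=> //; rewrite leq_addr.
  by apply: compE ck _ => e; rewrite negbK.
- have /andP[/rails[ka [ka' [ca ca']]] /rails[kb [kb' [cb cb']]]] := gk.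
  have [gs1 [k [ext1 ck]]] := nnf_and nnf ca cb; case: (ext1) => nnf1 _ keep1.
  have [gs2 [k' [ext2 ck']]] := nnf_or nnf1 (keep1 _ _ ca') (keep1 _ _ cb').
  case: (ext2) => _ _ keep2; exists gs2, k, k'; split.
  + exact: nnf_extends_trans ext1 ext2.
  + exact: keep2.
  + by apply: compE ck' _ => e; rewrite negb_and.
- have /andP[/rails[ka [ka' [ca ca']]] /rails[kb [kb' [cb cb']]]] := gk.
  have [gs1 [k [ext1 ck]]] := nnf_or nnf ca cb; case: (ext1) => nnf1 _ keep1.
  have [gs2 [k' [ext2 ck']]] := nnf_and nnf1 (keep1 _ _ ca') (keep1 _ _ cb').
  case: (ext2) => _ _ keep2; exists gs2, k, k'; split.
  + exact: nnf_extends_trans ext1 ext2.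
  + exact: keep2.
  + by apply: compE ck' _ => e; rewrite negb_or.
Qed.

(** The constant 1 starts the conjunction. Each output then costs six nodes: two literals, two
    conjunctions, their disjunction, and the gate joining it to the rest. *)
Lemma nnf_graph gs (psi : 'I_n -> (pvar n m -> bool) -> bool) (s : seq 'I_n) :
  nnf_nodes gs ->
  (forall i, exists k k',
     computes gs k (psi i) /\ computes gs k' (fun e => ~~ psi i e)) ->
  exists gs' k, nnf_extends gs (1 + 6 * size s) gs' /\
    computes gs' k (fun e =>
      all (fun i => e (PX i) && psi i e || e (PXbar i) && ~~ psi i e) s).
Proof.
move=> nnf rails; elim: s => [|i s [gs0 [k0 [ext0 c0]]]].
  by have [gs' [k c]] := nnf_const true nnf; exists gs', k.
have [k [k' [ck ck']]] := rails i.
have [nnf0 _ keep0] := ext0.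
have [gs1 [l [l' [ext1 cl cl']]]] := nnf_literals (X i) nnf0.
have [nnf1 _ keep1] := ext1.
have [gs2 [p [ext2 cp]]] := nnf_and nnf1 cl (keep1 _ _ (keep0 _ _ ck)).
have [nnf2 _ keep2] := ext2.
have [gs3 [q [ext3 cq]]] :=
  nnf_and nnf2 (keep2 _ _ cl') (keep2 _ _ (keep1 _ _ (keep0 _ _ ck'))).
have [nnf3 _ keep3] := ext3.
have [gs4 [r [ext4 cr]]] := nnf_or nnf3 (keep3 _ _ cp) cq.
have [nnf4 _ keep4] := ext4.
have [gs5 [o [ext5 co]]] := nnf_and nnf4 cr
  (keep4 _ _ (keep3 _ _ (keep2 _ _ (keep1 _ _ c0)))).
exists gs5, o; split=> //.
rewrite (_ : 1 + _ = 1 + 6 * size s + 2 + 1 + 1 + 1 + 1); last by rewrite /=; lia.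
exact: nnf_extends_trans (nnf_extends_trans (nnf_extends_trans
  (nnf_extends_trans (nnf_extends_trans ext0 ext1) ext2) ext3) ext4) ext5.
Qed.

Lemma skolem_SynNNF (F : spec n m) (Psi : circuit 'I_m n) :
  skolem_vector F Psi ->
  exists Ft : spec n m, [/\ SynNNF Ft, refines_syn Ft F
    & csize Ft <= 2 * csize Psi + (1 + 6 * csize F)].
Proof.
move=> skF; have [gs0 [nnf0 sz0 rails]] := nnf_double_rail (nodes_ok Psi).
pose psi i e := ceval Psi (fun j => e (@PY n m j)) i.
(* Outputs absent from [F] stay unconstrained: [F] ignores them, and a conjunct for each would make
   the size depend on [n]. *)
pose s := enum [set i | occurs (nodes F) i].
have [gs [k [[/andP[tgs nnf] sz _] [lk gsE]]]] :=
  nnf_graph (psi := psi) s nnf0 (fun i => rails _ (output_lt Psi i)).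
have out_ok : all (fun o => o < size gs) [tuple k] by rewrite /= lk.
pose Ft : spec n m := Circuit tgs out_ok.
have FtE x xb y : pholds Ft x xb y
    = all (fun i => x i && ceval Psi y i || xb i && ~~ ceval Psi y i) s.
  exact: gsE.
exists Ft; split.
- split=> // i [x [y]]; rewrite !alphaE !FtE; case/and3P=> /allP a11.
  set z := ceval Psi y => a10 a01.
  (* If [z i] is 1, the [i]-th conjunct already holds at [(1,0)], otherwise at [(0,1)]. The other
     conjuncts are those of [a11], so one of [a10], [a01] is contradicted. *)
  suff : z i || ~~ z i by case/orP => zi; [case/negP: a10 | case/negP: a01];
    apply/allP => l /[dup] ls /a11; case: (ltnP l i) => //= _;
    case: eqP => [->|//] _; rewrite ?zi ?orbT.
  exact: orbN.
- split=> [y _|y x' [/skF Fpsi]].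
    exists (ceval Psi y); rewrite holds_pholds FtE; apply/allP => i _.
    by rewrite !andbb orbN.
  (* A model of [Ft] agrees with the Skolem values on every output that [F] can see. *)
  rewrite holds_pholds FtE => /allP x'E; rewrite (eq_holds (x' := ceval Psi y)) //.
  move=> i occ; have := x'E i; rewrite mem_enum inE => /(_ occ).
  by case: (x' i); case: (ceval Psi y i).
rewrite (leq_trans sz) // leq_add // leq_add2l leq_mul2l /=.
by rewrite -cardE card_occurs.
Qed.

End FromSkolem.

(** Polynomial size has content only over a family of specifications, hence the index type [I] and
    one polynomial for all [t]. Both translations work on each member separately. *)
Theorem theorem8 (I : Type) (n m : I -> nat)
    (F : forall t : I, spec (n t) (m t)) :
  (exists p : {poly nat}, forall t : I,
     exists Psi : circuit 'I_(m t) (n t),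
       skolem_vector (F t) Psi /\ csize Psi <= horner p (csize (F t)))
  <->
  (exists q : {poly nat}, forall t : I,
     exists Ft : spec (n t) (m t),
       SynNNF Ft /\ refines_syn Ft (F t) /\
       csize Ft <= horner q (csize (F t))).
Proof.
split=> [[p skF]|[q synF]].
(* Two rails per node of [Psi], then one constant and six nodes per output occurring in [F], of
   which there are at most [csize (F t)]. *)
- exists (2%:P * p + (1 + 6%:P * 'X))%R => t; have [Psi [skPsi szPsi]] := skF t.
  have [Ft [synFt refFt szFt]] := skolem_SynNNF skPsi; exists Ft; do 2!split=> //.
  rewrite (leq_trans szFt) // !(hornerD, hornerM, hornerC, hornerX).
  by rewrite leq_add2r leq_mul2l szPsi orbT.
(* The quadratic bound for the copies of [Ft], composed with [q]. *)
- exists (1 + q * q)%R => t; have [Ft [synFt [[refE refH] szFt]]] := synF t.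
  have [Psi [szPsi PsiP]] := SynNNF_skolem_circuit synFt; exists Psi; split.
    (* The first refinement condition supplies a model of [Ft], the Skolem circuit of [Ft] turns it
       into the model [Psi(y)], and the second condition carries this back to [F]. *)
    move=> y; split=> [exF|Fy]; last by exists (ceval Psi y).
    by have [x' /PsiP Ftx'] := refE y exF; apply: refH.
  rewrite (leq_trans szPsi) // !(hornerD, hornerM, hornerC).
  by rewrite leq_add2l leq_mul.
Qed.
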